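(* Let $t\ge 6$ be an integer and set $$\alpha=\frac{1}{4}\left(t+\sqrt{(t-4)t+8}+\sqrt{2}\sqrt{t\left(t+\sqrt{(t-4)t+8}-2\right)-4}\right),\qquad \lambda=\frac{1}{\sqrt{(t-4)t+8}}.$$ Then $\alpha$ is a Salem number which is a root of $x^{4}-tx^{3}+tx^{2}-tx+1$, and the sequence $(E(\lambda\alpha^{n}))_{n=1}^\infty$ is a linear divisibility sequence with characteristic polynomial $x^{4}-tx^{3}+tx^{2}-tx+1$. In particular, for all positive integers $d,n$, $$d\mid n\ \Rightarrow\ E(\lambda\alpha^{d})\mid E(\lambda\alpha^{n}).$$
   Context: For a real number $x$, $E(x)$ denotes the nearest integer to $x$, i.e. $x=E(x)+\epsilon(x)$ with $\epsilon(x)\in[-\frac12,\frac12]$. A Salem number is a real algebraic integer $\tau>1$ of degree $d\geq 4$ all of whose conjugates, except $\tau$ and $\tau^{-1}$, lie on the unit circle. A linear divisibility sequence over $\mathbb{Z}$ is an integer sequence $(a_n)$ that satisfies a linear recurrence with constant coefficients and such that $m\mid n$ implies $a_m\mid a_n$ (conventionally $a_0=0$). *)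

(* Defs.v *)
From mathcomp Require Import all_boot all_order all_algebra.
From mathcomp Require Import complex.
From mathcomp Require Import reals.

Set Implicit Arguments.
Unset Strict Implicit.
Unset Printing Implicit Defensive.

Import Order.TTheory GRing.Theory Num.Theory.

Local Open Scope ring_scope.
Local Open Scope complex_scope.

(* The value of E at half-integers is left free, as both neighbours are then
   nearest integers. *)
Definition nearest_integer_fun (R : realType) (E : R -> int) : Prop :=
  forall x : R, exists2 eps : R,
    x = (E x)%:~R + eps & - (1 / 2%:R) <= eps <= 1 / 2%:R.

Definition minimal_polynomial (R : realType) (x : R) (p : {poly rat}) : Prop :=
  [/\ p \is monic, irreducible_poly p & root (map_poly ratr p) x].

(* The conjugates of tau are the complex roots of its minimal polynomial over
   the rationals, so its degree is (size p).-1. *)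
Definition is_Salem (R : realType) (tau : R) : Prop :=
  [/\ 1 < tau,
      integralOver (fun m : int => m%:~R : R) tau
    & exists p : {poly rat},
      [/\ minimal_polynomial tau p,
          (4 <= (size p).-1)%N
        & forall z : R[i], root (map_poly ratr p) z ->
            z != tau%:C -> z != (tau^-1)%:C -> `|z| = 1]].

(* For p = x^k + c_(k-1) x^(k-1) + ... + c_0 this is the recurrence
   a_(n+k) + c_(k-1) a_(n+k-1) + ... + c_0 a_n = 0 for all n. *)
Definition satisfies_recurrence (p : {poly int}) (a : nat -> int) : Prop :=
  p \is monic /\
  forall n : nat, \sum_(i < size p) p`_i * a (n + i)%N = 0.

Definition linear_divisibility_sequence
    (p : {poly int}) (a : nat -> int) : Prop :=
  [/\ satisfies_recurrence p a,
      a 0%N = 0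
    & forall m n : nat, (m %| n)%N -> (a m %| a n)%Z].

(* A sequence (u_n) given for n >= 1, completed by the convention u_0 = 0. *)
Definition extend0 (u : nat -> int) (n : nat) : int :=
  if n == 0%N then 0 else u n.

Definition quarticP (t : int) : {poly int} :=
  'X^4 - t *: 'X^3 + t *: 'X^2 - t *: 'X + 1.

Definition alpha (R : realType) (t : int) : R :=
  let T : R := t%:~R in
  let s := Num.sqrt ((T - 4%:R) * T + 8%:R) in
  1 / 4%:R *
    (T + s + Num.sqrt 2%:R * Num.sqrt (T * (T + s - 2%:R) - 4%:R)).

Definition lambda (R : realType) (t : int) : R :=
  let T : R := t%:~R in 1 / Num.sqrt ((T - 4%:R) * T + 8%:R).

(* Main.v *)
Require Import Defs.
From mathcomp Require Import all_boot all_order all_algebra.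
From mathcomp Require Import complex.
From mathcomp Require Import reals.
From mathcomp Require Import ring lra zify.

Set Implicit Arguments.
Unset Strict Implicit.
Unset Printing Implicit Defensive.

Import Order.TTheory GRing.Theory Num.Theory.

Local Open Scope ring_scope.

(** The quartic P = x^4 - t x^3 + t x^2 - t x + 1 is reciprocal.  In terms of
    the trace y = x + 1/x the equation P(x) = 0 reads y^2 - t y + (t - 2) = 0,
    whose roots y1 > y2 are real with difference s = sqrt((t - 4) t + 8).  So
    P = (x^2 - y1 x + 1) (x^2 - y2 x + 1) ([quarticP_reciprocal]); here alpha
    is the large root of the first factor, and |y2| < 2 puts both roots of the
    second one on the unit circle.  Irreducibility follows from Gauss's lemma
    and a comparison of coefficients: a linear factor would have root 1 or -1,
    and a quadratic one would make (t - 4) t + 8 a square, although it lies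
    strictly between (t - 2)^2 and (t - 1)^2.

    Let V_n be the Dickson polynomial, V_n(x + 1/x) = x^n + x^(-n), and put
    u_n = (V_n(y1) - V_n(y2)) / (y1 - y2).  Reducing V_n modulo
    X^2 - t X + (t - 2) shows that u_n is an integer.  Since
    V_(kd) = V_k o V_d, the quotient u_(kd) / u_d is the same divided
    difference of V_k, taken at the points V_d(y1) and V_d(y2), whose sum and
    product are again integers; hence u_d divides u_(kd)
    ([dickson_diff_dvd]).  Finally
      lambda alpha^n - u_n = (V_n(y2) - alpha^(-n)) / s,
    and for n > 0 the inequalities |V_n(y2)| <= 2, alpha >= 5, s > 22/5 bound
    this by (2 + 1/5) / s < 1/2, so u_n is the integer nearest to lambda alpha^n
    ([nearest_seqE]). *)

(** * Dickson polynomials *)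

Section Dickson.
Variable A : comPzRingType.

(** Carries (V_n(y), V_(n+1)(y)), so that the two-step recurrence of the Dickson
    polynomials with parameter 1 becomes a structural recursion. *)
Fixpoint dickson_pair (y : A) (n : nat) : A * A :=
  if n is m.+1 then let: (a, b) := dickson_pair y m in (b, y * b - a)
  else (2%:R, y).

Definition dickson (y : A) (n : nat) : A := (dickson_pair y n).1.

Lemma dickson0 y : dickson y 0 = 2%:R. Proof. by []. Qed.

Lemma dickson1 y : dickson y 1 = y. Proof. by []. Qed.

Lemma dicksonSS y n :
  dickson y n.+2 = y * dickson y n.+1 - dickson y n.
Proof. by rewrite /dickson /=; case: (dickson_pair y n). Qed.

Lemma nat_ind_two_step (P : nat -> Prop) :
  P 0%N -> P 1%N -> (forall n, P n -> P n.+1 -> P n.+2) -> forall n, P n.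
Proof.
move=> P0 P1 PSS n; suff: P n /\ P n.+1 by case.
by elim: n => [|n [Pn PSn]]; split=> //; apply: PSS.
Qed.

(** For y = x + 1/x this is (x^d + x^-d) (x^(m+d) + x^-(m+d)), expanded.  The
    recurrence alone proves it, so no such x has to exist in the ring. *)
Lemma dicksonD y d m :
  dickson y (m + d + d) + dickson y m = dickson y d * dickson y (m + d).
Proof.
elim/nat_ind_two_step: d m => [|| d IH0 IH1] m.
- by rewrite !addn0 dickson0; ring.
- by rewrite !addn1 dicksonSS dickson1; ring.
rewrite dicksonSS mulrBl -mulrA.
have -> : (m + d.+2 = m.+1 + d.+1)%N by lia.
rewrite -IH1.
have -> : (m.+1 + d.+1 = m.+2 + d)%N by lia.
rewrite -IH0.
have -> : (m.+2 + d + d.+2 = (m.+2 + d + d).+2)%N by lia.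
have -> : (m.+2 + d + d.+1 = (m.+2 + d + d).+1)%N by lia.
by rewrite !dicksonSS; ring.
Qed.

Lemma dicksonM y d k : dickson y (k * d) = dickson (dickson y d) k.
Proof.
elim/nat_ind_two_step: k => [|| k IH0 IH1].
- by rewrite mul0n.
- by rewrite mul1n.
rewrite dicksonSS -IH0 -IH1 mulSn addnC mulSn addnC.
by rewrite [(d + k * d)%N]addnC addnC -dicksonD addrK.
Qed.

(** The step (a, b) |-> (b, y b - a) preserves the quadratic form
    a^2 - y a b + b^2, whose value is read off at n = 0. *)
Lemma dickson_invariant y n :
  dickson y n.+1 ^+ 2 - y * dickson y n.+1 * dickson y n + dickson y n ^+ 2
    = 4%:R - y ^+ 2.
Proof.
elim: n => [|n IH]; first by rewrite dickson0 dickson1; ring.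
by rewrite -IH dicksonSS; ring.
Qed.

(** If y = x + 1/x, the hypothesis says that x is a root of
    x^4 - t x^3 + t x^2 - t x + 1, and so is 1/x; the sequence
    x^n + x^(-n) then satisfies the corresponding recurrence. *)
Lemma dickson_recurrence (t y : A) n : y ^+ 2 = t * y - (t - 2%:R) ->
  dickson y n.+4 - t * dickson y n.+3 + t * dickson y n.+2
    - t * dickson y n.+1 + dickson y n = 0.
Proof.
move=> hy; rewrite !dicksonSS.
set b := dickson y n.+1; set a := dickson y n.
transitivity ((y ^+ 2 - t * y + (t - 2%:R)) * (y * b - a)); first by ring.
by rewrite hy; ring.
Qed.

(** Reduction of V_k modulo X^2 - p X + q.  The integers u and w are chosen
    before y, hence are the same for both roots of the quadratic. *)
Lemma dickson_mod_quadratic (p q : int) k : exists u w : int,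
  forall y : A, y ^+ 2 = p%:~R * y - q%:~R ->
  dickson y k = u%:~R * y + w%:~R.
Proof.
elim/nat_ind_two_step: k => [||k [u [w IH0]] [u' [w' IH1]]].
- by exists 0, 2%:R => y _; rewrite dickson0; ring.
- by exists 1, 0 => y _; rewrite dickson1; ring.
exists (u' * p + w' - u), (- u' * q - w) => y hy.
rewrite dicksonSS IH0 // IH1 //.
transitivity (u'%:~R * y ^+ 2 + w'%:~R * y - u%:~R * y - w%:~R); first by ring.
by rewrite hy !(rmorphM, rmorphB, rmorphD, rmorphN) /=; ring.
Qed.

Lemma dickson_diff (p q : int) (y z : A) k :
  y + z = p%:~R -> y * z = q%:~R ->
  exists u : int, dickson y k - dickson z k = u%:~R * (y - z).
Proof.
move=> hp hq; have [u [w huw]] := dickson_mod_quadratic p q k.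
exists u; rewrite (huw y) ?(huw z); first (by ring);
  by rewrite -hp -hq; ring.
Qed.

(** Composition turns the left-hand side into a difference of V_k at V_d(y) and
    V_d(z).  These two points are again the roots of a monic integral
    quadratic, because V_d(y) = u y + w and V_d(z) = u z + w with common
    integers u and w. *)
Lemma dickson_diff_dvd (p q : int) (y z : A) d k :
  y + z = p%:~R -> y * z = q%:~R ->
  exists u : int, dickson y (k * d) - dickson z (k * d)
                  = u%:~R * (dickson y d - dickson z d).
Proof.
move=> hp hq; have [u [w huw]] := dickson_mod_quadratic p q d.
have hy : dickson y d = u%:~R * y + w%:~R.
  by apply: huw; rewrite -hp -hq; ring.
have hz : dickson z d = u%:~R * z + w%:~R.
  by apply: huw; rewrite -hp -hq; ring.
rewrite !dicksonM.
apply: (@dickson_diff (u * p + w *+ 2) (u ^+ 2 * q + u * w * p + w ^+ 2)).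
  rewrite hy hz !(rmorphM, rmorphXn, rmorphMn, rmorphD) /= -hp; ring.
rewrite hy hz !(rmorphM, rmorphXn, rmorphMn, rmorphD) /= -hp -hq; ring.
Qed.

End Dickson.

Lemma dickson_sum_inv (F : fieldType) (x : F) n : x != 0 ->
  dickson (x + x^-1) n = x ^+ n + x^-1 ^+ n.
Proof.
move=> x0; elim/nat_ind_two_step: n => [|| n IH0 IH1].
- by rewrite dickson0 !expr0.
- by rewrite dickson1 !expr1.
rewrite dicksonSS IH0 IH1 !exprS.
by move: (x ^+ n) (x^-1 ^+ n) => a b; field.
Qed.

(** Completing the square in [dickson_invariant] gives
    (4 - y^2) (4 - a^2) = (2 b - y a)^2 >= 0 for a = V_n(y), b = V_(n+1)(y). *)
Lemma dickson_bound (F : realFieldType) (y : F) n :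
  `|y| < 2%:R -> `|dickson y n| <= 2%:R.
Proof.
rewrite ltr_norml => /andP[y1 y2].
have hy : 0 < 4%:R - y ^+ 2 by nra.
have := dickson_invariant y n.
set b := dickson y n.+1; set a := dickson y n => h.
have h2 : (4%:R - y ^+ 2) * (4%:R - a ^+ 2) = (2%:R * b - y * a) ^+ 2.
  by transitivity (4%:R * (4%:R - y ^+ 2) - (4%:R - y ^+ 2) * a ^+ 2);
    [ring | rewrite -{1}h; ring].
have h3 : 0 <= 4%:R - a ^+ 2.
  by rewrite -(pmulr_rge0 _ hy) h2 sqr_ge0.
rewrite ler_norml; apply/andP; split; nra.
Qed.

(** * Irreducibility of the quartic *)

Lemma quarticP_seq (t : int) :
  quarticP t = [:: 1; - t; t; - t; 1] :> seq int.
Proof.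
rewrite -[RHS](@PolyK _ 0) //; congr polyseq.
apply/polyP => i; rewrite coef_Poly /quarticP.
by case: i => [|[|[|[|[|i]]]]]; rewrite !coefE /= ?nth_nil; ring.
Qed.

Lemma quarticP_monic t : quarticP t \is monic.
Proof. by rewrite monicE lead_coefE quarticP_seq. Qed.

Lemma size_quarticP t : size (quarticP t) = 5%N.
Proof. by rewrite quarticP_seq. Qed.

Lemma horner_quarticP (A : comNzRingType) (f : {rmorphism int -> A}) t x :
  (map_poly f (quarticP t)).[x] =
  x ^+ 4 - f t * x ^+ 3 + f t * x ^+ 2 - f t * x + 1.
Proof.
rewrite /quarticP !(rmorphD, rmorphN, rmorph1) /= !map_polyZ !map_polyXn ?map_polyX.
by rewrite !(hornerD, hornerN, hornerZ, hornerXn, hornerX, hornerC).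
Qed.

Lemma intM_eq1 (a b : int) : 1 = a * b -> a = 1 /\ b = 1 \/ a = -1 /\ b = -1.
Proof.
move=> h; have a0 : a != 0 by apply/eqP => a0; rewrite a0 mul0r in h.
have : `|a|%N * `|b|%N = 1 by lia.
by move/eqP; rewrite muln_eq1 => /andP[/eqP ? /eqP ?]; nia.
Qed.

(** (t - 2)^2 < (t - 4) t + 8 < (t - 1)^2. *)
Lemma disc_nonsquare (t m : int) : 6 <= t -> m ^+ 2 != (t - 4) * t + 8.
Proof.
move=> ht; apply/eqP => h.
wlog m0 : m h / 0 <= m.
  by move=> H; case: (lerP 0 m) => ?; [apply: (H m)|apply: (H (- m)); lia].
have h1 : t - 2 < m by nia.
have h2 : m < t - 1 by nia.
by lia.
Qed.

(** In a linear times cubic factorization the linear factor has coefficients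
    1 or -1, but neither 1 nor -1 is a root.  In a product
    (a2 x^2 + a1 x + a0) (b2 x^2 + b1 x + b0) the outer coefficients are units;
    opposite signs make the coefficients of x and x^3 opposite, whereas both
    are - t, and equal signs make (a1 - b1)^2 the discriminant (t - 4) t + 8. *)
Lemma quarticP_factor_le (t : int) (f g : {poly int}) : 6 <= t ->
  quarticP t = f * g -> (size f <= size g)%N -> size f = 1%N.
Proof.
move=> ht hfg sfg.
have fg0 : f * g != 0 by rewrite -hfg monic_neq0 // quarticP_monic.
have /norP[f0 g0] : ~~ ((f == 0) || (g == 0)) by rewrite -mulf_eq0.
have szfg : (size f + size g = 6)%N.
  have := size_quarticP t; rewrite hfg size_mul // => h.
  by rewrite -(prednK (_ : 0 < size f + size g)%N) ?h // addn_gt0 size_poly_gt0 f0.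
have co i : (quarticP t)`_i = \sum_(j < i.+1) f`_j * g`_(i - j).
  by rewrite hfg coefM.
move: (co 0%N) (co 1%N) (co 2%N) (co 3%N) (co 4%N).
rewrite quarticP_seq !big_ord_recr !big_ord0 /= /bump /=.
have szf : (0 < size f)%N by rewrite size_poly_gt0.
move: szf szfg sfg.
case sg: (size g) => [|m];
  case sf: (size f) => [|[|[|[|n]]]] // _ szfg sfg; try by lia.
  have [-> ->] : f`_2 = 0 /\ f`_3 = 0 by split; apply: nth_default; rewrite sf.
  have [-> ->] : f`_4 = 0 /\ g`_4 = 0 by split; apply: nth_default; rewrite ?sf ?sg; lia.
  rewrite ?subn0 ?subnn ?subSS.
  move: f`_0 f`_1 g`_0 g`_1 g`_2 g`_3 => a0 a1 b0 b1 b2 b3.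
  rewrite !(mul0r, mulr0, addr0, add0r) => c0 c1 c2 c3 c4.
  case: (intM_eq1 c0) => [[? ?]|[? ?]];
    case: (intM_eq1 c4) => [[? ?]|[? ?]]; subst; lia.
have [-> ->] : f`_4 = 0 /\ f`_3 = 0 by split; apply: nth_default; rewrite sf.
have [-> ->] : g`_3 = 0 /\ g`_4 = 0 by split; apply: nth_default; rewrite ?sf ?sg; lia.
rewrite ?subn0 ?subnn ?subSS.
move: f`_0 f`_1 f`_2 g`_0 g`_1 g`_2 => a0 a1 a2 b0 b1 b2.
rewrite !(mul0r, mulr0, addr0, add0r) => c0 c1 c2 c3 c4.
case: (intM_eq1 c0) => [[? ?]|[? ?]];
    case: (intM_eq1 c4) => [[? ?]|[? ?]]; subst; try lia.
- by have /eqP[] := disc_nonsquare (a1 - b1) ht; nia.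
- by have /eqP[] := disc_nonsquare (a1 - b1) ht; nia.
Qed.

Lemma quarticP_factor (t : int) (f g : {poly int}) : 6 <= t ->
  quarticP t = f * g -> size f = 1%N \/ size g = 1%N.
Proof.
move=> ht hfg; case: (leqP (size f) (size g)) => [le_fg | /ltnW le_gf].
  by left; apply: quarticP_factor_le hfg le_fg.
by right; apply: (@quarticP_factor_le t g f) => //; rewrite hfg mulrC.
Qed.

Lemma quarticP_irreducible (t : int) : 6 <= t ->
  irreducible_poly (map_poly (intr : int -> rat) (quarticP t)).
Proof.
move=> ht; split=> [|q q1 /[dup] q_dvd /dvdpP_rat_int[f [c c0 hq] [g hfg]]].
  by rewrite size_rat_int_poly size_quarticP.
have sq : size q = size f by rewrite hq size_scale // size_rat_int_poly.
rewrite -(dvdp_size_eqp q_dvd) sq size_rat_int_poly hfg.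
have fg0 : f * g != 0 by rewrite -hfg monic_neq0 // quarticP_monic.
have /norP[f0 g0] : ~~ ((f == 0) || (g == 0)) by rewrite -mulf_eq0.
case: (quarticP_factor ht hfg) => [f1|g1]; first by rewrite sq f1 in q1.
by rewrite size_mul // g1 addn1.
Qed.

(** * The roots of the quartic *)

Lemma quarticP_reciprocal (A : comNzRingType) (f : {rmorphism int -> A}) t
    (y z x : A) : y + z = f t -> y * z = f t - 2%:R ->
  (map_poly f (quarticP t)).[x]
    = (x ^+ 2 - y * x + 1) * (x ^+ 2 - z * x + 1).
Proof.
move=> hs hp; rewrite horner_quarticP.
transitivity (x ^+ 4 - (y + z) * x ^+ 3 + (y * z + 2%:R) * x ^+ 2
              - (y + z) * x + 1); last by ring.
by rewrite hp hs; ring.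
Qed.

(** The imaginary part of the equation gives z real, impossible since the
    discriminant y^2 - 4 is negative, or Re z = y / 2, and then the real part
    reads |z|^2 = 1. *)
Lemma norm_root_elliptic (R : rcfType) (y : R) (z : R[i]) : `|y| < 2%:R ->
  z ^+ 2 - (y%:C)%C * z + 1 = 0 -> `|z| = 1.
Proof.
rewrite ltr_norml => /andP[y1 y2]; case: z => a b /eqP.
rewrite expr2 eq_complex /= => /andP[/eqP hre /eqP him].
suff h : a ^+ 2 + b ^+ 2 = 1 by rewrite normc_def /= h sqrtr1.
have {}him : b * (2%:R * a - y) = 0 by rewrite -him; ring.
have {}hre : a ^+ 2 - b ^+ 2 - y * a + 1 = 0 by rewrite -hre; ring.
move/eqP: him; rewrite mulf_eq0 => /orP[/eqP b0|/eqP ay].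
  have : 0 < 4%:R - y ^+ 2 by nra.
  have := sqr_ge0 (2%:R * a - y).
  have -> : (2%:R * a - y) ^+ 2 = - (4%:R - y ^+ 2).
    by apply/eqP; rewrite -subr_eq0 -(mulr0 4%:R) -hre b0; apply/eqP; ring.
  by lra.
have -> : 1 = y * a + b ^+ 2 - a ^+ 2 by rewrite -[RHS]addr0 -hre; ring.
have -> : y = 2%:R * a by apply/eqP; rewrite -subr_eq0 -opprB ay oppr0.
by ring.
Qed.

Section Alpha.
Variables (R : realType) (t : int).
Hypothesis ht : 6 <= t.

Let T : R := t%:~R.

(** [trace1] and [trace2] are the roots of y^2 - t y + (t - 2), the values
    of x + 1/x at the roots x of the quartic. *)
Definition sqrt_disc : R := Num.sqrt ((T - 4%:R) * T + 8%:R).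
Definition trace1 : R := (T + sqrt_disc) / 2%:R.
Definition trace2 : R := (T - sqrt_disc) / 2%:R.

Let T6 : 6%:R <= T.
Proof. by rewrite /T -[6%:R]/(6%:~R) ler_int. Qed.

Lemma sqrt_disc_sqr : sqrt_disc ^+ 2 = (T - 4%:R) * T + 8%:R.
Proof. by rewrite sqr_sqrtr //; nra. Qed.

Lemma sqrt_disc_ge0 : 0 <= sqrt_disc.
Proof. exact: sqrtr_ge0. Qed.

Lemma sqrt_disc_gt : 22%:R / 5%:R < sqrt_disc.
Proof.
have hD : 20%:R <= sqrt_disc ^+ 2 by rewrite sqrt_disc_sqr; have := T6; nra.
by have := sqrt_disc_ge0; nra.
Qed.

Lemma trace_add : trace1 + trace2 = T.
Proof. by rewrite /trace1 /trace2; field. Qed.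

Lemma trace_mul : trace1 * trace2 = T - 2%:R.
Proof.
transitivity ((T ^+ 2 - sqrt_disc ^+ 2) / 4%:R).
  by rewrite /trace1 /trace2; field.
by rewrite sqrt_disc_sqr; field.
Qed.

Lemma trace_sub : trace1 - trace2 = sqrt_disc.
Proof. by rewrite /trace1 /trace2; field. Qed.

Lemma trace2_lt2 : `|trace2| < 2%:R.
Proof.
have := sqrt_disc_sqr; have := sqrt_disc_ge0.
rewrite ltr_norml /trace2; have := T6; move: sqrt_disc => s T6' s0 hs.
have h1 : s < T + 4%:R by nra.
have h2 : T - 4%:R < s by nra.
by apply/andP; split; lra.
Qed.

(** Since s > 22/5, the product of the last two roots in alpha is at least 48/5,
    hence 4 alpha >= 6 + 22/5 + 48/5 = 20. *)
Lemma alpha_ge5 : 5%:R <= alpha R t.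
Proof.
rewrite /alpha -/T -/sqrt_disc -sqrtrM //.
have s44 := sqrt_disc_gt.
set e := _ * (_ - _).
have he : 2304%:R / 25%:R <= e.
  have : 0 <= (T - 6%:R) * (sqrt_disc - 22%:R / 5%:R).
    by apply: mulr_ge0; have := T6; lra.
  by rewrite /e; have := T6; nra.
have hc : Num.sqrt e ^+ 2 = e by rewrite sqr_sqrtr //; lra.
have : 48%:R / 5%:R <= Num.sqrt e by have := sqrtr_ge0 e; nra.
by have := T6; lra.
Qed.

Lemma alpha_root_trace1 : alpha R t ^+ 2 - trace1 * alpha R t + 1 = 0.
Proof.
rewrite /alpha -/T -/sqrt_disc -sqrtrM //.
have s44 := sqrt_disc_gt; have hs := sqrt_disc_sqr.
set e := _ * (_ - _).
have he : Num.sqrt e ^+ 2 = e by rewrite sqr_sqrtr // /e; have := T6; nra.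
rewrite /trace1.
move: (Num.sqrt e) he; rewrite /e; move: sqrt_disc hs => s hs c he.
transitivity ((c ^+ 2 - (T + s) ^+ 2 + 16%:R) / 16%:R); first by field.
rewrite he.
transitivity (((T - 4%:R) * T + 8%:R - s ^+ 2) / 16%:R); first by field.
by rewrite hs subrr mul0r.
Qed.

Lemma alpha_neq0 : alpha R t != 0.
Proof. by apply: lt0r_neq0; have := alpha_ge5; lra. Qed.

Lemma trace1_alpha : trace1 = alpha R t + (alpha R t)^-1.
Proof.
apply: (mulIf alpha_neq0); rewrite mulrDl mulVf ?alpha_neq0 //.
by apply/eqP; rewrite eq_sym -subr_eq0 -expr2 addrAC alpha_root_trace1.
Qed.

Lemma alpha_root :
  root (map_poly (fun m : int => m%:~R : R) (quarticP t)) (alpha R t).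
Proof.
rewrite /root (@quarticP_reciprocal _ intr _ trace1 trace2).
- by rewrite alpha_root_trace1 mul0r.
- exact: trace_add.
- exact: trace_mul.
Qed.

Lemma alpha_Salem : is_Salem (alpha R t).
Proof.
split; first by have := alpha_ge5; lra.
  exists (quarticP t); [exact: quarticP_monic | exact: alpha_root].
exists (map_poly intr (quarticP t)); split.
- split; [|exact: quarticP_irreducible|].
    exact/monic_map/quarticP_monic.
  rewrite -map_poly_comp (eq_map_poly (g := intr)); last exact: ratr_int.
  exact: alpha_root.
- by rewrite size_rat_int_poly size_quarticP.
move=> z; rewrite -map_poly_comp (eq_map_poly (g := intr)); last exact: ratr_int.
have hT : ((T%:C)%C : R[i]) = t%:~R by rewrite rmorph_int.
rewrite /root (@quarticP_reciprocal _ intr _ (trace1%:C)%C (trace2%:C)%C) /=.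
- rewrite mulf_eq0 => /orP[|/eqP hz _ _]; last first.
    exact: norm_root_elliptic trace2_lt2 hz.
  have -> : z ^+ 2 - (trace1%:C)%C * z + 1
      = (z - ((alpha R t)%:C)%C) * (z - ((alpha R t)^-1%:C)%C).
    have haa : ((alpha R t)%:C)%C * ((alpha R t)^-1%:C)%C = 1 :> R[i].
      by rewrite -rmorphM /= mulfV ?alpha_neq0.
    by rewrite -haa trace1_alpha rmorphD /=; ring.
  by rewrite mulf_eq0 !subr_eq0 => /orP[->|->].
- by rewrite -rmorphD trace_add.
- by rewrite -rmorphM trace_mul rmorphB /= hT rmorph_nat.
Qed.

End Alpha.

(** * The sequence of nearest integers *)

Lemma nearest_integer_eq (R : realType) (E : R -> int) (x : R) (m : int) :
  nearest_integer_fun E -> `|x - m%:~R| < 1 / 2%:R -> E x = m.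
Proof.
move=> /(_ x)[e hx he]; move: hx he; move: (E x) => k -> /andP[e1 e2].
rewrite ltr_norml => /andP[h1 h2].
have h3 : (k%:~R : R) < (m + 1)%:~R by rewrite rmorphD /=; lra.
have h4 : ((m - 1)%:~R : R) < k%:~R by rewrite rmorphB /=; lra.
rewrite !ltr_int in h3 h4.
by apply/eqP; rewrite eq_le -ltzD1 h3 /= -ltzD1 -ltrBlDr.
Qed.

Section Sequence.
Variables (R : realType) (E : R -> int).
Hypothesis hE : nearest_integer_fun E.
Variable t : int.
Hypothesis ht : 6 <= t.

Let a := extend0 (fun n : nat => E (lambda R t * alpha R t ^+ n)).
Let s := sqrt_disc R t.
Let V1 := dickson (trace1 R t).
Let V2 := dickson (trace2 R t).

Let s_gt0 : 0 < s.
Proof. by have := sqrt_disc_gt R ht; rewrite -/s; lra. Qed.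

(** At n = 0 both sides vanish because of the convention a_0 = 0.  For n > 0 the
    estimate uses alpha^(-n) <= 1/5, so that
    |lambda alpha^n - u_n| <= (2 + 1/5) / s < 1/2. *)
Lemma nearest_seqE n : (a n)%:~R * s = V1 n - V2 n.
Proof.
have hmul : trace1 R t * trace2 R t = (t - 2%:R)%:~R.
  by rewrite trace_mul // rmorphB.
have [u hu] := dickson_diff n (trace_add R t) hmul.
rewrite /V1 /V2 hu trace_sub -/s; congr (_%:~R * _).
rewrite /a /extend0; case: eqP => [n0|/eqP n0].
  have : u%:~R * s = 0 by rewrite /s -trace_sub -hu n0 !dickson0 subrr.
  by move/eqP; rewrite mulf_eq0 (gt_eqF s_gt0) orbF intr_eq0 => /eqP ->.
apply: nearest_integer_eq => //.
have a5 := alpha_ge5 R ht.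
have := dickson_bound n (trace2_lt2 R ht).
move: hu; rewrite {1}trace1_alpha // dickson_sum_inv ?alpha_neq0 // trace_sub -/s.
rewrite /lambda -/(sqrt_disc R t) -/s.
have i5 : (alpha R t)^-1 ^+ n <= 5%:R^-1.
  case: n n0 => // m _; rewrite exprS.
  have i1 : (alpha R t)^-1 <= 5%:R^-1 by rewrite lef_pV2 ?posrE //; lra.
  have i2 : 0 <= (alpha R t)^-1 by rewrite invr_ge0; lra.
  apply: le_trans i1; rewrite ler_piMr // exprn_ile1 //.
  by rewrite invf_le1; lra.
have i0 : 0 <= (alpha R t)^-1 ^+ n by rewrite exprn_ge0 // invr_ge0; lra.
move: (dickson _ n) (_ ^+ n) (_^-1 ^+ n) i5 i0 => v x x' i5 i0 hu.
rewrite !ler_norml => /andP[v1 v2].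
have -> : 1 / s * x - u%:~R = (v - x') / s.
  by apply: (mulIf (lt0r_neq0 s_gt0)); rewrite mulrBl -hu; field; rewrite gt_eqF.
rewrite normrM normfV (gtr0_norm s_gt0) ltr_pdivrMr // ltr_norml.
have := sqrt_disc_gt R ht; rewrite -/s => s44.
by apply/andP; split; lra.
Qed.

Lemma nearest_seq_divisibility : linear_divisibility_sequence (quarticP t) a.
Proof.
have s0 := lt0r_neq0 s_gt0.
have hmul : trace1 R t * trace2 R t = (t - 2%:R)%:~R.
  by rewrite trace_mul // rmorphB.
split=> //; first (split; first exact: quarticP_monic).
  move=> n; apply/eqP; rewrite -(intr_eq0 R) -(mulrI_eq0 _ (mulfI s0)).
  rewrite quarticP_seq !big_ord_recr big_ord0 /= /bump /= !addn0 !addnS addn0.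
  rewrite !(rmorphM, rmorphD, rmorphN, rmorph1) /=.
  have h1 : trace1 R t ^+ 2 = t%:~R * trace1 R t - (t%:~R - 2%:R).
    by rewrite -trace_mul // -(trace_add R t); ring.
  have h2 : trace2 R t ^+ 2 = t%:~R * trace2 R t - (t%:~R - 2%:R).
    by rewrite -trace_mul // -(trace_add R t); ring.
  have := dickson_recurrence n h1; have := dickson_recurrence n h2.
  have := nearest_seqE n; have := nearest_seqE n.+1; have := nearest_seqE n.+2.
  have := nearest_seqE n.+3; have := nearest_seqE n.+4; rewrite /V1 /V2.
  move: (dickson (trace1 R t)) (dickson (trace2 R t)) => W1 W2 e4 e3 e2 e1 e0 r2 r1.
  rewrite add0r.
  apply/eqP; transitivity ((a n)%:~R * s - t%:~R * ((a n.+1)%:~R * s)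
    + t%:~R * ((a n.+2)%:~R * s) - t%:~R * ((a n.+3)%:~R * s) + (a n.+4)%:~R * s).
    by ring.
  by rewrite e4 e3 e2 e1 e0 -[RHS](subrr 0) -{1}r1 -r2; ring.
move=> d n /dvdnP[k ->].
have [u hu] := dickson_diff_dvd d k (trace_add R t) hmul.
apply/dvdzP; exists u; apply/(@intr_inj R)/(mulIf s0).
by rewrite rmorphM /= -mulrA !nearest_seqE hu.
Qed.

End Sequence.

Theorem mainTheorem3 (R : realType) (E : R -> int)
    (hE : nearest_integer_fun E) (t : int) (ht : 6 <= t) :
  [/\ is_Salem (alpha R t),
      root (map_poly (fun m : int => m%:~R : R) (quarticP t)) (alpha R t),
      linear_divisibility_sequence (quarticP t)
        (extend0 (fun n : nat => E (lambda R t * alpha R t ^+ n)))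
    & forall d n : nat, (0 < d)%N -> (0 < n)%N -> (d %| n)%N ->
        (E (lambda R t * alpha R t ^+ d)%R %|
         E (lambda R t * alpha R t ^+ n)%R)%Z].
Proof.
have lds := nearest_seq_divisibility hE ht.
split=> //; [exact: alpha_Salem | exact: alpha_root |].
case: lds => _ _ dvd_a [|d] [|n] // _ _.
exact: dvd_a.
Qed.
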